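(* Let $f:\mathbb{N}\to\mathbb{N}$ be non-decreasing. There is a map $F_f:\mathbb{N}\times\mathbb{N}\to\mathbb{N}$ such that the following holds: if $G$ is a finite simple graph of tree-depth less than $t$, $\ell$ is a $\mathcal G$-labeling of $G$ for some finite abelian group $\mathcal G$ with $|\mathcal G|\leq N$, and $G$ has more than $F_f(N,t)$ vertices, then $(G,\ell)$ contains clones $C_1,\ldots,C_r$ with $r\geq f(|C_1|)$. Moreover, if $f$ is computable, then so is $F_f$.
   Context: A $\mathcal G$-labeling of $G$ is a map $\ell:V(G)\to\mathcal G$. Tree-depth is defined recursively: the graph with no vertices has tree-depth $0$; a connected graph $G$ has tree-depth $k+1$ if it does not have tree-depth at most $k$ but there is $v\in V(G)$ such that every component of $G-v$ has tree-depth at most $k$; a disconnected graph has tree-depth equal to the maximum tree-depth of its components. In a labeled graph $(G,\ell)$, non-empty sets $C_1,\ldots,C_r\subseteq V(G)$, each inducing a connected subgraph, are called clones if they are pairwise disjoint and for any two $i,j\in[r]$ there is no edge between $C_i$ and $C_j$ and there is an automorphism $\pi$ of $G$ with $\ell\circ\pi=\ell$ and $\pi(C_i)=C_j$ that fixes every vertex of $V(G)\setminus(C_i\cup C_j)$. *)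

(* Defs.v *)
From mathcomp Require Import all_boot all_order all_fingroup all_algebra.

Set Implicit Arguments.
Unset Strict Implicit.
Unset Printing Implicit Defensive.

Lemma geq_bigminn (I : finType) (P : pred I) (F : I -> nat) (x : nat) (i : I) :
  P i -> \big[minn/x]_(j | P j) F j <= F i.
Proof.
move=> Pi; elim: (index_enum I) (mem_index_enum i) => // j s IHs.
rewrite inE big_cons => /predU1P[<-|/IHs le_s]; first by rewrite Pi geq_minl.
by case: ifP => // _; apply: leq_trans (geq_minr _ _) le_s.
Qed.

Record sgraph := SGraph {
  vertex :> finType;
  adj : rel vertex;
  adj_sym : symmetric adj;
  adj_irrefl : irreflexive adj }.

Section Graphs.
Variable G : sgraph.
Implicit Types (S C D : {set G}) (v : G).

(* The induced subgraph G[S] is represented by S, with edges [induced_adj S]. *)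
Definition induced_adj S : rel G :=
  [rel x y | [&& x \in S, y \in S & adj x y]].

(* The empty set is connected in this sense. *)
Definition connected_in S : bool :=
  [forall x in S, forall y in S, connect (induced_adj S) x y].

Definition components S : {set {set G}} :=
  [set [set y in S | connect (induced_adj S) x y] | x in S].

(* Tree-depth of G[S], with fuel n; any n >= #|S| gives the same value
   ([td_fuel_irrel]).  The default #|S| of \big[minn/_] is an upper bound
   for all the terms, so it does not affect the minimum.  The
   defining clauses are [tree_depth0], [tree_depth_conn] and
   [tree_depth_disconn]. *)
Fixpoint td_fuel (n : nat) S : nat :=
  if n is n'.+1 then
    if S == set0 then 0
    else if connected_in S then
      (\big[minn/#|S|]_(v in S) \max_(C in components (S :\ v)) td_fuel n' C).+1
    else \max_(C in components S) td_fuel n' C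
  else 0.

Definition tree_depth_of S : nat := td_fuel #|S| S.

Definition tree_depth : nat := tree_depth_of [set: G].

Lemma component_sub S C : C \in components S -> C \subset S.
Proof.
by case/imsetP=> x _ ->; apply/subsetP=> y; rewrite inE => /andP[].
Qed.

Lemma component_proper S C :
  ~~ connected_in S -> C \in components S -> C \proper S.
Proof.
move=> ncS CS; rewrite properEneq (component_sub CS) andbT.
apply: contra ncS => /eqP eCS; case/imsetP: CS => x xS eC.
have cx y : y \in S -> connect (induced_adj S) x y.
  by rewrite -{1}eCS eC inE => /andP[].
have sym : connect_sym (induced_adj S).
  by apply: sym_connect_sym => a b; rewrite /induced_adj /= adj_sym andbCA.
apply/forall_inP=> a aS; apply/forall_inP=> b bS.
by apply: connect_trans (cx b bS); rewrite sym cx.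
Qed.

Lemma component_del S v C :
  v \in S -> C \in components (S :\ v) -> #|C| < #|S|.
Proof.
move=> vS /component_sub /subset_leq_card leC.
by rewrite (cardsD1 v S) vS.
Qed.

Lemma td_fuel_irrel n m S :
  #|S| <= n -> #|S| <= m -> td_fuel n S = td_fuel m S.
Proof.
elim: n m S => [|n IHn] [|m] S //=.
- by rewrite leqn0 cards_eq0 => ->.
- by move=> _; rewrite leqn0 cards_eq0 => ->.
move=> Sn Sm; case: eqP => // _; case: ifPn => [_|ncS].
  congr _.+1; apply: eq_bigr => v vS; apply: eq_bigr => C CS.
  by have lt := component_del vS CS; apply: IHn; rewrite -ltnS (leq_trans lt).
apply: eq_bigr => C CS; have lt := proper_card (component_proper ncS CS).
by apply: IHn; rewrite -ltnS (leq_trans lt).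
Qed.

Lemma td_fuelE n S : #|S| <= n -> td_fuel n S = tree_depth_of S.
Proof. by move=> Sn; apply: td_fuel_irrel. Qed.

Lemma tree_depth_ofE S :
  tree_depth_of S =
    if S == set0 then 0
    else if connected_in S then
      (\big[minn/#|S|]_(v in S)
          \max_(C in components (S :\ v)) tree_depth_of C).+1
    else \max_(C in components S) tree_depth_of C.
Proof.
rewrite -(@td_fuelE #|S|.+1) //=; case: eqP => // _; case: ifPn => [_|ncS].
  congr _.+1; apply: eq_bigr => v vS; apply: eq_bigr => C CS.
  exact/td_fuelE/ltnW/(component_del vS CS).
apply: eq_bigr => C CS.
exact/td_fuelE/ltnW/proper_card/(component_proper ncS CS).
Qed.

Lemma tree_depth_of_card S : tree_depth_of S <= #|S|.
Proof.
have [n] := ubnP #|S|; elim: n S => // n IHn S /ltnSE Sn.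
rewrite tree_depth_ofE; case: eqP => // /eqP S0; case: ifPn => [_|ncS].
  have [v vS] := set0Pn _ S0.
  rewrite (leq_ltn_trans (geq_bigminn _ _ vS)) //.
  rewrite (cardsD1 v S) vS ltnS; apply/bigmax_leqP => C CS.
  apply: leq_trans (subset_leq_card (component_sub CS)).
  by apply: IHn; apply: leq_trans (component_del vS CS) Sn.
apply/bigmax_leqP => C CS; have lt := proper_card (component_proper ncS CS).
by apply: leq_trans (ltnW lt); apply: IHn; apply: leq_trans lt Sn.
Qed.

Lemma tree_depth0 : tree_depth_of set0 = 0.
Proof. by rewrite tree_depth_ofE eqxx. Qed.

Lemma tree_depth_conn S k : S != set0 -> connected_in S ->
  (tree_depth_of S = k.+1 <->
     ~ tree_depth_of S <= k /\
     exists2 v, v \in S &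
       forall C, C \in components (S :\ v) -> tree_depth_of C <= k).
Proof.
move=> S0 cS; rewrite tree_depth_ofE (negPf S0) cS.
set M := fun v => \max_(C in components (S :\ v)) tree_depth_of C.
rewrite -/(M _); set m := \big[minn/_]_(v in S) _.
have mM v : v \in S -> m <= M v.
  by move=> vS; apply: geq_bigminn.
split=> [[<-]|[/negP]]; last first.
  rewrite -ltnNge ltnS => km [v vS vk].
  congr _.+1; apply/eqP; rewrite eqn_leq -ltnS km andbT ltnS.
  by apply: leq_trans (mM v vS) _; apply/bigmax_leqP.
split; first by rewrite ltnn.
have [v vS vm] : exists2 v, v \in S & M v <= m.
  have [v vS] := set0Pn _ S0.
  have vS' : M v <= #|S|.
    apply/bigmax_leqP => C /(component_del vS) /ltnW.
    exact/leq_trans/tree_depth_of_card.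
  rewrite /m; elim/big_ind: _ => [|a b Ha Hb|w wS]; first by exists v.
    by rewrite /minn; case: ifP.
  by exists w.
by exists v => // C CS; apply: leq_trans vm; apply: leq_bigmax_cond.
Qed.

Lemma tree_depth_disconn S : ~~ connected_in S ->
  tree_depth_of S = \max_(C in components S) tree_depth_of C.
Proof.
move=> ncS; rewrite tree_depth_ofE (negPf ncS); case: eqP => // S0.
case/negP: ncS; rewrite S0; apply/forall_inP => x; by rewrite inE.
Qed.

Definition automorphism (p : {perm G}) : Prop :=
  forall x y, adj (p x) (p y) = adj x y.

Definition clones (L : Type) (l : G -> L) (r : nat) (C : 'I_r -> {set G}) :
    Prop :=
  (forall i, C i != set0 /\ connected_in (C i)) /\
  (forall i j, i != j ->
    [/\ [disjoint C i & C j],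
        forall x y, x \in C i -> y \in C j -> ~~ adj x y
      & exists p : {perm G},
          [/\ automorphism p, l \o p =1 l, p @: C i = C j
            & forall x, x \notin C i :|: C j -> p x = x]]).

End Graphs.

(* Computability is defined through the mu-recursive functions: [mrec n] are
   the programs of arity n and [computes p v y] means that p halts with value y
   on input v.  Primitive recursion is on the first argument. *)
Inductive mrec : nat -> Type :=
| MZero n : mrec n
| MSucc : mrec 1
| MProj n : 'I_n -> mrec n
| MComp m n : mrec m -> ('I_m -> mrec n) -> mrec n
| MPrec n : mrec n -> mrec n.+2 -> mrec n.+1
| MMin n : mrec n.+1 -> mrec n.

(* In the primitive recursion clause, s lists the successive values. *)
Fixpoint computes (n : nat) (p : mrec n) : n.-tuple nat -> nat -> Prop :=
  match p in mrec n return n.-tuple nat -> nat -> Prop with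
  | MZero _ => fun _ y => y = 0
  | MSucc => fun v y => y = (thead v).+1
  | MProj _ i => fun v y => y = tnth v i
  | MComp m _ g h => fun v y =>
      exists2 w : m.-tuple nat,
        forall i, computes (h i) v (tnth w i) & computes g w y
  | MPrec n g h => fun v y =>
      exists s : nat -> nat,
        [/\ computes g [tuple of behead v] (s 0),
            forall k, k < thead v ->
              computes h [tuple of k :: s k :: behead v] (s k.+1)
          & y = s (thead v)]
  | MMin _ g => fun v y =>
      computes g [tuple of y :: v] 0 /\
      forall j, j < y -> exists z, computes g [tuple of j :: v] z.+1
  end.

Lemma computes_functional n (p : mrec n) v y z :
  computes p v y -> computes p v z -> y = z.
Proof.
elim: p v y z => {n} [n|| n i|m n g IHg h IHh|n g IHg h IHh|n g IHg] v y z /=.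
- by move=> -> ->.
- by move=> -> ->.
- by move=> -> ->.
- move=> [w hw gw] [w' hw' gw'].
  have ew : w = w' by apply: eq_from_tnth => i; apply: IHh (hw i) (hw' i).
  by rewrite -ew in gw'; apply: IHg gw gw'.
- move=> [s [s0 sS ->]] [s' [s0' sS' ->]].
  suff ss' k : k <= thead v -> s k = s' k by apply: ss'.
  elim: k => [_|k IHk lt]; first exact: IHg s0 s0'.
  move: (sS _ lt) (sS' _ lt); rewrite (IHk (ltnW lt)); exact: IHh.
- move=> [gy y_min] [gz z_min]; case: (ltngtP y z) => // [/z_min|/y_min] [u].
    by move/(IHg _ _ _ gy).
  by move/(IHg _ _ _ gz).
Qed.

Definition computable1 (f : nat -> nat) : Prop :=
  exists p : mrec 1, forall a, computes p [tuple a] (f a).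

Definition computable2 (F : nat -> nat -> nat) : Prop :=
  exists p : mrec 2, forall a b, computes p [tuple a; b] (F a b).

(* Main.v *)
Require Import Defs.
From mathcomp Require Import all_boot all_order all_fingroup all_algebra.

(** Induct on the tree-depth of an induced subgraph G[S] whose vertices carry a
colouring recording the label and the adjacency to each vertex outside S.
Deleting a vertex v from a component of G[S] lowers the tree-depth, at the price
of doubling the number of colours to remember the adjacency to v, so all
components of G[S] have bounded size m. There are boundedly many isomorphism
types of coloured graphs on at most m vertices; hence either the number of
components, and so #|S|, is bounded, or f m components share a type. Components
of the same type can be exchanged by an automorphism fixing all other vertices,
because the colours control the edges leaving S: these components are clones.
The number of colours never exceeds 2 ^ t * N, so the resulting bound is a
[t]-fold iteration of a map that is primitive recursive in f. *)

Set Implicit Arguments.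
Unset Strict Implicit.
Unset Printing Implicit Defensive.

(** * Closure properties of computable functions, and the bound *)

Definition computableT (n : nat) (F : n.-tuple nat -> nat) : Prop :=
  exists p : mrec n, forall v, computes p v (F v).

Lemma tuple1E (v : 1.-tuple nat) : v = [tuple tnth v ord0].
Proof.
by apply: eq_from_tnth => i; rewrite (ord1 i) !(tnth_nth 0).
Qed.

Lemma tuple2E (v : 2.-tuple nat) : v = [tuple tnth v ord0; tnth v (inord 1)].
Proof.
apply: eq_from_tnth => -[[|[|i]] //= lt_i]; rewrite !(tnth_nth 0) //=.
by rewrite inordK.
Qed.

Lemma computable1T g :
  computable1 g <-> computableT (fun v : 1.-tuple nat => g (tnth v ord0)).
Proof.
split=> -[p pF]; exists p; first by move=> v; rewrite {1}(tuple1E v).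
by move=> a; apply: (pF [tuple a]).
Qed.

Lemma computable2T F :
  computable2 F <->
  computableT (fun v : 2.-tuple nat => F (tnth v ord0) (tnth v (inord 1))).
Proof.
split=> -[p pF]; exists p; first by move=> v; rewrite {1}(tuple2E v).
by move=> a b; have := pF [tuple a; b]; rewrite !(tnth_nth 0) /= inordK.
Qed.

Lemma computableT_proj n (i : 'I_n) :
  computableT (fun v : n.-tuple nat => tnth v i).
Proof. by exists (MProj i). Qed.

Lemma computableT_comp1 n g (F : n.-tuple nat -> nat) :
  computable1 g -> computableT F -> computableT (fun v => g (F v)).
Proof.
move=> [p pg] [q qF]; exists (MComp p (fun=> q)) => v /=.
by exists [tuple F v] => // i; rewrite (ord1 i); apply: qF.
Qed.

Lemma computableT_comp2 n g (F F' : n.-tuple nat -> nat) :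
  computable2 g -> computableT F -> computableT F' ->
  computableT (fun v => g (F v) (F' v)).
Proof.
move=> [p pg] [q qF] [q' qF'].
exists (MComp p (fun i : 'I_2 => if i == ord0 then q else q')) => v /=.
by exists [tuple F v; F' v] => // -[[|[|i]]] //= lt_i; rewrite (tnth_nth 0) /=.
Qed.

Lemma computable1_succ : computable1 S.
Proof. by exists MSucc. Qed.

Lemma computableT_const n (c : nat) : computableT (fun _ : n.-tuple nat => c).
Proof.
elim: c => [|c IHc]; first by exists (MZero n).
exact: computableT_comp1 computable1_succ IHc.
Qed.

Lemma computable2_prec F (base : nat -> nat) (step : nat -> nat -> nat -> nat) :
  computable1 base ->
  computableT (fun v : 3.-tuple nat =>
    step (tnth v ord0) (tnth v (inord 1)) (tnth v (inord 2))) ->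
  (forall b, F 0 b = base b) ->
  (forall a b, F a.+1 b = step a (F a b) b) ->
  computable2 F.
Proof.
move=> [p pbase] [q qstep] F0 FS; exists (MPrec p q) => a b /=.
exists (F^~ b); split => //= [|k _].
  by have := pbase b; rewrite F0; congr computes; apply: val_inj.
rewrite FS; have := qstep [tuple k; F k b; b].
rewrite !(tnth_nth 0) /= !inordK //=; congr computes; exact: val_inj.
Qed.

Lemma computable1_id : computable1 id.
Proof. exact/computable1T/computableT_proj. Qed.

Lemma computable1_const c : computable1 (fun=> c).
Proof. exact/computable1T/computableT_const. Qed.

Lemma computable2_swap F : computable2 F -> computable2 (fun a b => F b a).
Proof.
by move=> F2; apply/computable2T/computableT_comp2 => //; apply: computableT_proj.
Qed.

Lemma computable2_add : computable2 addn.
Proof.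
apply: (@computable2_prec _ id (fun _ s _ => s.+1)) => //.
- exact: computable1_id.
- exact/(computableT_comp1 computable1_succ)/computableT_proj.
Qed.

Lemma computable2_mul : computable2 muln.
Proof.
apply: (@computable2_prec _ (fun=> 0) (fun _ s b => b + s)) => //.
- exact: computable1_const.
- by apply: (computableT_comp2 computable2_add); apply: computableT_proj.
Qed.

Lemma computable2_exp : computable2 expn.
Proof.
(* [MPrec] recurses on the first argument, [expn] on its second. *)
apply/computable2_swap/(@computable2_prec _ (fun=> 1) (fun _ s b => b * s)).
- exact: computable1_const.
- by apply: (computableT_comp2 computable2_mul); apply: computableT_proj.
- by move=> b; apply: expn0.
- by move=> a b; apply: expnS.
Qed.

Lemma computable2_iter (step : nat -> nat -> nat) c :
  computable2 step -> computable2 (fun k M => iter k (step M) c).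
Proof.
move=> step2; apply: (@computable2_prec _ (fun=> c) (fun _ s M => step M s)) => //.
- exact: computable1_const.
- by apply: (computableT_comp2 step2); apply: computableT_proj.
Qed.

(* M bounds the number of colours and b the size of a component minus a vertex;
   the sets of at most b + 1 vertices have at most
   (M + 1) ^ (b + 1) * 2 ^ ((b + 1) ^ 2) coloured types. *)
Definition clone_step (f : nat -> nat) (M b : nat) : nat :=
  b.+1 * (M.+1 ^ b.+1 * 2 ^ (b.+1 * b.+1) * f b.+1).

(** The colour bound [2 ^ t * N] is fixed in advance, so one map is iterated; the start [0] is the
    size at tree-depth 0. *)
Definition clone_bound (f : nat -> nat) (N t : nat) : nat :=
  iter t (clone_step f (2 ^ t * N)) 0.

Lemma computable2_clone_step f :
  computable1 f -> computable2 (clone_step f).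
Proof.
move=> f1; apply/computable2T.
have b1 := computableT_comp1 computable1_succ (computableT_proj (inord 1 : 'I_2)).
have M1 := computableT_comp1 computable1_succ (computableT_proj (ord0 : 'I_2)).
have mul n F F' := @computableT_comp2 n _ F F' computable2_mul.
have exp n F F' := @computableT_comp2 n _ F F' computable2_exp.
apply: (mul _ _ _ b1 (mul _ _ _ _ (computableT_comp1 f1 b1))).
exact: (mul _ _ _ (exp _ _ _ M1 b1) (exp _ _ _ (computableT_const 2 2) (mul _ _ _ b1 b1))).
Qed.

Lemma computable2_clone_bound f :
  computable1 f -> computable2 (clone_bound f).
Proof.
move=> /computable2_clone_step/computable2_iter => /(_ 0) iter2.
apply/computable2T/(computableT_comp2 iter2); first exact: computableT_proj.
apply: (computableT_comp2 computable2_mul); last exact: computableT_proj.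
apply: (computableT_comp2 computable2_exp); last exact: computableT_proj.
exact: computableT_const.
Qed.

(** * Components of induced subgraphs and tree-depth *)

Section Components.
Variable G : sgraph.
Implicit Types (S C D : {set G}) (x y v : G).

Lemma induced_connect_sym S : connect_sym (induced_adj S).
Proof.
by apply: sym_connect_sym => a b; rewrite /induced_adj /= adj_sym andbCA.
Qed.

Lemma component_adj S C x y :
  C \in components S -> x \in C -> y \in S -> adj x y -> y \in C.
Proof.
case/imsetP=> z zS ->; rewrite !inE => /andP[xS zx] yS xy; rewrite yS.
by apply: connect_trans zx (connect1 _); rewrite /induced_adj /= xS yS.
Qed.

Lemma component_meet S C D x :
  C \in components S -> D \in components S -> x \in C -> x \in D -> C = D.
Proof.
move=> /imsetP[a aS ->] /imsetP[b bS ->]; rewrite !inE => /andP[xS ax].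
case/andP=> _ bx; apply/setP=> y; rewrite !inE; congr andb.
apply: (same_connect (@induced_connect_sym S)).
by apply: connect_trans ax _; rewrite induced_connect_sym.
Qed.

Lemma component_neq0 S C : C \in components S -> C != set0.
Proof.
by case/imsetP=> x xS ->; apply/set0Pn; exists x; rewrite inE xS connect0.
Qed.

Lemma component_connected S C : C \in components S -> connected_in C.
Proof.
move=> CS; have [z zS eC] := imsetP CS.
have zC y : y \in C -> connect (induced_adj C) z y.
  rewrite {1}eC inE => /andP[_ /connectP[p]].
  have : z \in C by rewrite eC inE zS connect0.
  (* A path in [S] starting in [C] never leaves [C], so it is a path of the graph induced on [C]. *)
  elim: p (z) => [|w p IHp] x xC /= => [_ -> //|].
  case/andP=> /and3P[_ wS xw] wp ylast.
  have wC := component_adj CS xC wS xw.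
  apply: connect_trans (connect1 _) (IHp w wC wp ylast).
  by rewrite /induced_adj /= xC wC.
apply/forall_inP=> x xC; apply/forall_inP=> y yC.
by apply: connect_trans (zC y yC); rewrite induced_connect_sym zC.
Qed.

Lemma cover_components S : cover (components S) = S.
Proof.
apply/setP=> x; apply/bigcupP/idP=> [[C /component_sub/subsetP]|xS]; first exact.
exists [set y in S | connect (induced_adj S) x y]; first exact: imset_f.
by rewrite inE xS connect0.
Qed.

Lemma components_connected S C :
  connected_in S -> C \in components S -> C = S.
Proof.
move=> cS CS; apply/eqP; rewrite eqEsubset component_sub //=.
have [x xS ->] := imsetP CS; apply/subsetP=> y yS; rewrite inE yS.
by have /forall_inP/(_ x xS)/forall_inP/(_ y yS) := cS.
Qed.

(** A non-empty connected set is its own only component, so the connected and disconnected cases can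
    be treated alike. *)
Lemma tree_depth_of_leP S d :
  reflect (forall C, C \in components S -> tree_depth_of C <= d)
          (tree_depth_of S <= d).
Proof.
case: (boolP (connected_in S)) => [cS|ncS]; last first.
  by rewrite tree_depth_disconn //; apply: bigmax_leqP.
apply: (iffP idP) => [Sd C /(components_connected cS) -> //|Cd].
have [->|[x xS]] := set_0Vmem S; first by rewrite tree_depth0.
have CS := imset_f (fun x => [set y in S | connect (induced_adj S) x y]) xS.
by have := Cd _ CS; rewrite (components_connected cS CS).
Qed.

Lemma connected_del_vertex S d :
  S != set0 -> connected_in S -> tree_depth_of S <= d ->
  exists2 v, v \in S & tree_depth_of (S :\ v) < d.
Proof.
move=> S0 cS; case tdS: (tree_depth_of S) => [|k] kd.
  by move: tdS; rewrite tree_depth_ofE (negPf S0) cS.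
have [_ [v vS vk]] := (tree_depth_conn k S0 cS).1 tdS.
by exists v => //; apply: leq_trans kd; apply/tree_depth_of_leP.
Qed.

End Components.

(** * Exchanging two components of the same shape *)

Section Swap.
Variables (G : sgraph) (L : Type) (l : G -> L) (K : finType) (c : G -> K).
Variable x0 : G.
Implicit Types (S C D : {set G}) (x y v : G).

(* Over S, the colour of a vertex records its label and its neighbours
   outside S. *)
Definition refining S : Prop :=
  forall x y, x \in S -> y \in S -> c x = c y ->
    l x = l y /\ forall z, z \notin S -> adj x z = adj y z.

(* The isomorphism type of the coloured graph G[C], read off from the
   enumeration of C, when C has at most m elements. *)
Definition shape m C : {ffun 'I_m -> option K} * {ffun 'I_m * 'I_m -> bool} :=
  ([ffun i : 'I_m => if i < #|C| then Some (c (nth x0 (enum C) i)) else None],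
   [ffun ij : 'I_m * 'I_m => adj (nth x0 (enum C) ij.1) (nth x0 (enum C) ij.2)]).

(** Matches vertices by their position in the two enumerations, the order in which [shape] reads
    them. *)
Definition transfer C D x : G := nth x0 (enum D) (index x (enum C)).

Section Pair.
Variables (m : nat) (C D : {set G}).
Hypotheses (Cm : #|C| <= m) (Dm : #|D| <= m) (eCD : shape m C = shape m D).

(** If one set were larger, the entry at the cardinality of the smaller would be [Some] in one shape
    and [None] in the other. *)
Lemma shape_card : #|C| = #|D|.
Proof.
case: eCD => /ffunP eK _; apply/eqP; rewrite eqn_leq.
apply/andP; split; rewrite leqNgt; apply/negP=> lt.
- by have := eK (Ordinal (leq_trans lt Cm)); rewrite !ffunE /= lt ltnn.
- by have := eK (Ordinal (leq_trans lt Dm)); rewrite !ffunE /= lt ltnn.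
Qed.

Lemma index_enum_lt x : x \in C -> index x (enum C) < #|C|.
Proof. by move=> xC; rewrite cardE index_mem mem_enum. Qed.

Lemma transfer_in x : x \in C -> transfer C D x \in D.
Proof.
move=> xC; rewrite -mem_enum mem_nth // -cardE -shape_card.
exact: index_enum_lt.
Qed.

Lemma transferK x : x \in C -> transfer D C (transfer C D x) = x.
Proof.
move=> xC; rewrite /transfer index_uniq ?enum_uniq //.
  by rewrite nth_index ?mem_enum.
by rewrite -cardE -shape_card index_enum_lt.
Qed.

Lemma transfer_color x : x \in C -> c (transfer C D x) = c x.
Proof.
move=> xC; have lt := index_enum_lt xC.
case: eCD => /ffunP/(_ (Ordinal (leq_trans lt Cm))) + _.
by rewrite !ffunE /= -shape_card lt => -[]; rewrite nth_index ?mem_enum.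
Qed.

Lemma transfer_adj x y :
  x \in C -> y \in C -> adj (transfer C D x) (transfer C D y) = adj x y.
Proof.
move=> xC yC; have ltx := index_enum_lt xC; have lty := index_enum_lt yC.
case: eCD => _ /ffunP/(_ (Ordinal (leq_trans ltx Cm), Ordinal (leq_trans lty Cm))).
by rewrite !ffunE /= !nth_index ?mem_enum.
Qed.

End Pair.

Definition swap_fun C D x : G :=
  if x \in C then transfer C D x else if x \in D then transfer D C x else x.

Lemma swap_componentsP m S C D :
  refining S -> C \in components S -> D \in components S -> C != D ->
  #|C| <= m -> #|D| <= m -> shape m C = shape m D ->
  exists p : {perm G}, [/\ automorphism p, l \o p =1 l, p @: C = D
                         & forall x, x \notin C :|: D -> p x = x].
Proof.
move=> refS CS DS nCD Cm Dm eCD; have eDC := esym eCD.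
have dis x : x \in C -> x \in D -> false.
  by move=> xC xD; case/eqP: nCD; apply: component_meet CS DS xC xD.
have CinD x : x \in C -> x \in D = false by move=> xC; apply/negP => /(dis x xC).
have DinC x : x \in D -> x \in C = false by move=> xD; apply/negP => /dis/(_ xD).
have inD := transfer_in Cm Dm eCD; have inC := transfer_in Dm Cm eDC.
have sC x : x \in C -> x \in S by apply/subsetP/component_sub.
have sD x : x \in D -> x \in S by apply/subsetP/component_sub.
have swapK : involutive (swap_fun C D).
  move=> x; rewrite /swap_fun; case: (boolP (x \in C)) => xC.
    by rewrite (DinC _ (inD _ xC)) (inD _ xC) (transferK Cm Dm eCD).
  case: (boolP (x \in D)) => xD; last by rewrite (negPf xC) (negPf xD).
  by rewrite inC // (transferK Dm Cm eDC).
exists (perm (inv_inj swapK)).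
have colS x : (swap_fun C D x = x) \/
    [/\ x \in S, swap_fun C D x \in S & c (swap_fun C D x) = c x].
  rewrite /swap_fun; case: (boolP (x \in C)) => xC.
    by right; rewrite sC ?sD ?inD // (transfer_color Cm Dm eCD).
  case: (boolP (x \in D)) => xD; last by left.
  by right; rewrite sD ?sC ?inC // (transfer_color Dm Cm eDC).
have noadj E x y : E \in components S -> x \in E -> y \in S -> y \in E = false ->
    adj x y = false.
  by move=> ES xE yS yE; apply: contraFF yE => /(component_adj ES xE yS).
(* If [x] moves, then for [y] in [S] both sides are false, as [y] lies in another component; for [y]
   outside [S] the colour of [x] determines adjacency. *)
have outer x y : y \notin C :|: D -> adj (swap_fun C D x) y = adj x y.
  rewrite inE => /norP[yC yD]; case: (boolP (y \in S)) => yS; last first.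
    by case: (colS x) => [-> //|[xS xS' /refS-/(_ xS' xS)[_]]]; apply.
  rewrite /swap_fun; case: (boolP (x \in C)) => xC.
    rewrite (noadj _ _ _ DS (inD _ xC)) ?(negPf yD) //.
    by rewrite (noadj _ _ _ CS xC) // (negPf yC).
  case: (boolP (x \in D)) => xD //.
  rewrite (noadj _ _ _ CS (inC _ xD)) ?(negPf yC) //.
  by rewrite (noadj _ _ _ DS xD) // (negPf yD).
have fixed x : x \notin C :|: D -> swap_fun C D x = x.
  by rewrite inE /swap_fun => /norP[/negPf-> /negPf->].
split=> [x y|x||x xCD].
- rewrite !permE.
  case: (boolP (y \in C :|: D)) => yCD; last by rewrite (fixed y) // outer.
  case: (boolP (x \in C :|: D)) => xCD; last first.
    by rewrite (fixed x) // adj_sym outer // adj_sym.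
  (* Both vertices move: within one component the shape preserves adjacency, and across the two
     there are no edges before or after. *)
  move: xCD yCD; rewrite !inE /swap_fun.
  case: (boolP (x \in C)) => xC /= xD; case: (boolP (y \in C)) => yC /= yD.
  + exact: (transfer_adj Cm eCD).
  + rewrite yD (noadj D) ?inD ?(sC _ (inC _ yD)) ?(CinD _ (inC _ yD)) //.
    by rewrite (noadj C) ?(sD _ yD) ?(negPf yC).
  + rewrite xD (noadj C) ?inC ?(sD _ (inD _ yC)) ?(DinC _ (inD _ yC)) //.
    by rewrite (noadj D) ?(sC _ yC) ?(CinD _ yC).
  + by rewrite xD yD (transfer_adj Dm eDC).
- by rewrite /= permE; case: (colS x) => [-> //|[xS xS' /refS-/(_ xS' xS)[]]].
- apply/setP=> y; apply/imsetP/idP=> [[x xC ->]|yD].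
    by rewrite permE /swap_fun xC inD.
  exists (swap_fun C D y); last by rewrite permE swapK.
  by rewrite /swap_fun (DinC y yD) yD inC.
- by rewrite permE fixed.
Qed.

End Swap.

(** * Counting components and the induction on tree-depth *)

Lemma card_fibres_leq (T U : finType) (h : T -> U) (P : {set T}) k :
  (forall u, #|[set x in P | h x == u]| <= k) -> #|P| <= #|U| * k.
Proof.
move=> le_k; rewrite -sum1_card (partition_big h predT) //= -sum_nat_const.
apply: leq_sum => u _; apply: leq_trans (le_k u).
by rewrite -sum1_card; apply/eq_leq/eq_bigl => x; rewrite inE.
Qed.

Lemma card_leq_components (G : sgraph) (S : {set G}) m :
  (forall C, C \in components S -> #|C| <= m) -> #|S| <= #|components S| * m.
Proof.
move=> le_m; rewrite -{1}(cover_components S).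
apply: leq_trans (leq_card_cover _) _.
by rewrite -sum_nat_const; apply: leq_sum.
Qed.

(** The index type ['I_r.+1] makes the family non-empty, so that [C ord0] exists. *)
Definition has_clones (f : nat -> nat) (G : sgraph) (L : Type) (l : G -> L) :=
  exists (r : nat) (C : 'I_r.+1 -> {set G}),
    clones l C /\ f #|C ord0| <= r.+1.

Lemma same_shape_clones f (G : sgraph) (L : Type) (l : G -> L) (K : finType)
    (c : G -> K) (x0 : G) m (S : {set G}) (Q : {set {set G}}) u :
  {homo f : m n / m <= n} -> refining l c S -> Q \subset components S ->
  (forall C, C \in Q -> #|C| <= m /\ shape c x0 m C = u) -> f m < #|Q| ->
  has_clones f l.
Proof.
move=> f_mono refS /subsetP QS Qu fQ; case eQ: #|Q| (fQ) => [//|r] ltr.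
pose C (i : 'I_r.+1) := enum_val (cast_ord (esym eQ) i).
have CQ i : C i \in Q by apply: enum_valP.
exists r, C; split; last first.
  by have [/f_mono le_f _] := Qu _ (CQ ord0); apply: leq_trans le_f (ltnW ltr).
split=> [i|i j nij]; have CS k := QS _ (CQ k).
  by rewrite (component_neq0 (CS i)) (component_connected (CS i)).
have nC : C i != C j.
  by apply: contra nij => /eqP/enum_val_inj/cast_ord_inj->.
split.
- apply/pred0P=> x /=; apply/andP=> -[xi xj]; case/eqP: nC.
  exact: component_meet (CS i) (CS j) xi xj.
- move=> x y xi yj; apply/negP=> xy; case/eqP: nC.
  have yS : y \in S by apply: (subsetP (component_sub (CS j))).
  exact: component_meet (CS i) (CS j) (component_adj (CS i) xi yS xy) yj.
have [[Ci ui] [Cj uj]] := (Qu _ (CQ i), Qu _ (CQ j)).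
apply: (swap_componentsP (x0 := x0) refS (CS i) (CS j) nC Ci Cj).
by rewrite ui uj.
Qed.

(** Vertices of [S] outside [C] have no neighbours in [C], so the colours need no refinement. *)
Lemma refining_component (G : sgraph) (L : Type) (l : G -> L) (K : finType)
    (c : G -> K) (S C : {set G}) :
  refining l c S -> C \in components S -> refining l c C.
Proof.
move=> refS CS x y xC yC cxy; have sCS := subsetP (component_sub CS).
have [lxy adjxy] := refS x y (sCS _ xC) (sCS _ yC) cxy; split=> // z zC.
case: (boolP (z \in S)) => [zS|]; last exact: adjxy.
have noz w : w \in C -> adj w z = false.
  by move=> wC; apply: contraNF zC => /(component_adj CS wC zS).
by rewrite !noz.
Qed.

(** The only new outside vertex is [v], and the added bit records adjacency to it. *)
Lemma refining_del (G : sgraph) (L : Type) (l : G -> L) (K : finType)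
    (c : G -> K) (S : {set G}) v :
  refining l c S -> refining l (fun x => (c x, adj x v)) (S :\ v).
Proof.
move=> refS x y; rewrite !inE => /andP[_ xS] /andP[_ yS] [cxy axy].
have [lxy adjxy] := refS x y xS yS cxy; split=> // z.
by rewrite !inE negb_and negbK => /predU1P[->|/adjxy].
Qed.

(** The invariant [#|K| * 2 ^ d <= M] leaves room for [d] further doublings of the colours. *)
Lemma clone_step_clones f (G : sgraph) (L : Type) (l : G -> L) M d
    (K : finType) (c : G -> K) (S : {set G}) :
  {homo f : m n / m <= n} -> refining l c S ->
  #|K| * 2 ^ d <= M -> tree_depth_of S <= d ->
  iter d (clone_step f M) 0 < #|S| -> has_clones f l.
Proof.
move=> f_mono; elim: d K c S => [|d IHd] K c S refS KM Sd ltS.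
  (* At depth 0, deleting a vertex from a component would give negative tree-depth. *)
  have /set0Pn[x xS] : S != set0 by rewrite -card_gt0.
  have CS := imset_f (fun x => [set y in S | connect (induced_adj S) x y]) xS.
  have Cd := tree_depth_of_leP _ _ Sd _ CS.
  by have [] :=
    connected_del_vertex (component_neq0 CS) (component_connected CS) Cd.
move: ltS; rewrite iterS; set b := iter d _ 0 => ltS.
have /set0Pn[x0 _] : S != set0 by rewrite -card_gt0 (leq_ltn_trans _ ltS).
(* A component with more than [b.+1] vertices still has more than [b] after a deletion, so induction
   applies. *)
have [/forall_inP Cb|] := boolP [forall C in components S, #|C| <= b.+1]; last first.
  case/forall_inPn=> C CS; rewrite -ltnNge => ltC.
  have Cd := tree_depth_of_leP _ _ Sd _ CS.
  have [v vC vd] :=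
    connected_del_vertex (component_neq0 CS) (component_connected CS) Cd.
  apply: (IHd _ _ _ (refining_del (v := v) (refining_component refS CS))) => //.
    by rewrite card_prod card_bool -mulnA -expnS.
  by move: ltC; rewrite (cardsD1 v C) vC.
pose fibre u := [set C in components S | shape c x0 b.+1 C == u].
have [/forallP le_fib|] := boolP [forall u, #|fibre u| <= f b.+1]; last first.
  case/forallPn=> u; rewrite -ltnNge => lt.
  apply: (same_shape_clones f_mono refS _ _ lt).
    by apply/subsetP=> C; rewrite inE => /andP[].
  by move=> C; rewrite inE => /andP[CS /eqP shC]; split; [exact: Cb|exact: shC].
suff leS : #|S| <= clone_step f M b by rewrite ltnNge leS in ltS.
apply: leq_trans (card_leq_components Cb) _; rewrite mulnC leq_mul2l /=.
apply: leq_trans (card_fibres_leq le_fib) _; rewrite leq_mul2r.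
(* Number of shapes; [#|K| <= M] since the power of 2 in the invariant is positive. *)
rewrite card_prod !card_ffun card_option card_bool card_prod !card_ord.
rewrite leq_mul2r leq_exp2r // ltnS (leq_trans _ KM) ?orbT //.
by rewrite leq_pmulr ?expn_gt0.
Qed.

Theorem theorem5p3 (f : nat -> nat) (f_mono : {homo f : m n / m <= n}) :
  exists F : nat -> nat -> nat,
    (forall (N t : nat) (G : sgraph) (A : finZmodType) (l : G -> A),
       tree_depth G < t -> #|A| <= N -> F N t < #|G| ->
       exists (r : nat) (C : 'I_r.+1 -> {set G}),
         clones l C /\ f #|C ord0| <= r.+1) /\
    (computable1 f -> computable2 F).
Proof.
exists (clone_bound f); split; last exact: computable2_clone_bound.
move=> N t G A l td_t cardA lt_F.
(* The labels serve as the initial colours, since no vertex lies outside [[set: G]]. *)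
apply: (@clone_step_clones f G A l (2 ^ t * N) t A l [set: G]) => //.
- by move=> x y _ _ lxy; split=> // z; rewrite inE.
- by rewrite mulnC leq_mul2l cardA orbT.
- exact: ltnW.
- by rewrite cardsT.
Qed.
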